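(* Let $f_1,f_2,q_l,h_i,g_j$, the sets $\mathbf{K}_1,\mathbf{K}_2,\mathbf{Y}$ and the probability measure $\varphi$ on $\mathbf{Y}$ be as in the context, satisfying the standing assumption stated there. Consider the two-stage stochastic program with recourse $$\rho=\min_{x_1\in\mathbf{K}_1}\; f_1(x_1)+\int_{\mathbf{Y}} v^*(x_1,y)\,d\varphi(y),\qquad v^*(x_1,y)=\min_{x_2\in\mathbb{R}^{n_2}}\{f_2(x_1,x_2)\;:\;h_i(x_1,x_2,y)=0,\ i=1,\ldots,N_h,\ \ g_j(x_1,x_2,y)\ge 0,\ j=1,\ldots,N_g\},$$ and the generalized moment problem (GMP) $$\rho_{12}=\min_{\mu_1\in\mathcal{M}(\mathbf{K}_1)_+,\ \mu_2\in\mathcal{M}(\mathbf{K}_2)_+}\ \int_{\mathbf{K}_1} f_1\,d\mu_1+\int_{\mathbf{K}_2} f_2\,d\mu_2\quad\text{s.t.}\quad \int_{\mathbf{K}_1}d\mu_1=1,\quad \pi_{x_1,y}\mu_2=\mu_1\otimes\varphi .$$ The two problems are equivalent, in that: (a) $\rho_{12}=\rho$; and (b) if $x_1^*$ is an optimal solution of the two-stage program (i.e. $x_1^*\in\mathbf{K}_1$ attains $\rho$), then the GMP has an optimal solution $(\mu_1^*,\mu_2^* )$ whose first component is the Dirac measure $\mu_1^*=\delta_{x_1^*}$.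
   Context: Data: $n_1,n_2,p,N_q,N_h,N_g,N_g'$ are integers with $N_g'\ge N_g$; $x_1\in\mathbb{R}^{n_1}$ is the first-stage decision, $x_2\in\mathbb{R}^{n_2}$ the second-stage decision, $y\in\mathbb{R}^p$ an exogenous random parameter. Sets: $\mathbf{Y}:=\{y\in\mathbb{R}^p: g_j(y)\ge 0,\ j=N_g+1,\ldots,N_g'\}$; $\mathbf{K}_1:=\{x_1\in\mathbb{R}^{n_1}: q_l(x_1)\ge 0,\ l=1,\ldots,N_q\}$; $\mathbf{K}_2:=\{(x_1,x_2,y)\in\mathbb{R}^{n_1}\times\mathbb{R}^{n_2}\times\mathbb{R}^p: x_1\in\mathbf{K}_1,\ y\in\mathbf{Y},\ h_i(x_1,x_2,y)=0\ (i=1,\ldots,N_h),\ g_j(x_1,x_2,y)\ge 0\ (j=1,\ldots,N_g)\}$. $\varphi$ is a Borel probability measure on $\mathbf{Y}$, the distribution of $y$. Standing assumption: the functions $f_1(x_1)$, $f_2(x_1,x_2)$, $q_l(x_1)$, $h_i(x_1,x_2,y)$, $g_j$ are (real) polynomials; $\mathbf{K}_1,\mathbf{K}_2,\mathbf{Y}$ are compact; and for each $x_1\in\mathbf{K}_1$ and $y\in\mathbf{Y}$ there exists $\overline{x}_2\in\mathbb{R}^{n_2}$ with $(x_1,\overline{x}_2,y)\in\mathbf{K}_2$. Notation: $\mathcal{M}(\mathbf{C})_+$ is the cone of non-negative finite Borel measures on $\mathbf{C}$. In integrals over $\mathbf{K}_2$, $f_2$ is regarded as a function of $(x_1,x_2,y)$.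 The projection $\pi_{x_1,y}:\mathcal{M}(\mathbf{K}_2)_+\to\mathcal{M}(\mathbf{K}_1\times\mathbf{Y})_+$ is $(\pi_{x_1,y}\mu_2)(B)=\mu_2(\{(x_1,x_2,y)\in\mathbf{K}_2:(x_1,y)\in B\})$ for Borel $B\subseteq\mathbf{K}_1\times\mathbf{Y}$. $\mu_1\otimes\varphi$ is the product measure on $\mathbf{K}_1\times\mathbf{Y}$. *)

(* Defs.v *)
From HB Require Import structures.
From mathcomp Require Import all_boot all_order all_algebra.
From mathcomp Require Import all_classical all_reals all_analysis.
From mathcomp Require mpoly.

Set Implicit Arguments.
Unset Strict Implicit.
Unset Printing Implicit Defensive.

Import Order.TTheory GRing.Theory Num.Theory.
Import numFieldNormedType.Exports.

Local Open Scope classical_set_scope.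
Local Open Scope ring_scope.

(* 'rV[R]_n carries the Borel sigma-algebra of its topology. Products such as
   'rV[R]_m * 'rV[R]_n keep the library's product sigma-algebra; it is the Borel
   sigma-algebra of the product topology, these spaces being second countable. *)
HB.instance Definition _ (R : realType) (n : nat) :=
  @isMeasurable.Build (sigma_display (@open 'rV[R]_n)) 'rV[R]_n
    <<s @open 'rV[R]_n >> (@sigma_algebra0 _ setT _) (@sigma_algebraC _ _)
    (@sigma_algebra_bigcup _ setT _).

(* The constraints g_j with j <= Ng involve (x1, x2, y) and those with
   Ng < j <= Ng' involve y only; the latter form the family [rd_gY], whose index
   j : 'I_(Ng' - Ng) stands for Ng + 1 + j. *)
Record recourse_data (R : realType) (n1 n2 p Nq Nh Ng Ng' : nat) := RecourseData {
  rd_f1 : mpoly.mpoly n1 R;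
  rd_f2 : mpoly.mpoly (n1 + n2) R;
  rd_q : 'I_Nq -> mpoly.mpoly n1 R;
  rd_h : 'I_Nh -> mpoly.mpoly (n1 + n2 + p) R;
  rd_g : 'I_Ng -> mpoly.mpoly (n1 + n2 + p) R;
  rd_gY : 'I_(Ng' - Ng) -> mpoly.mpoly p R }.

Definition peval (R : realType) (n : nat) (P : mpoly.mpoly n R) (x : 'rV[R]_n) : R :=
  mpoly.meval (fun i => x 0 i) P.

Section Problem.
Context {R : realType} {n1 n2 p Nq Nh Ng Ng' : nat}.
Implicit Types (D : recourse_data R n1 n2 p Nq Nh Ng Ng').

Definition K1_set D : set 'rV[R]_n1 := [set x1 | forall l, 0 <= peval (rd_q D l) x1].

Definition Y_set D : set 'rV[R]_p := [set y | forall j, 0 <= peval (rd_gY D j) y].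

Definition stage2_feasible D (x1 : 'rV[R]_n1) (y : 'rV[R]_p) : set 'rV[R]_n2 :=
  [set x2 | (forall i, peval (rd_h D i) (row_mx (row_mx x1 x2) y) = 0) /\
            (forall j, 0 <= peval (rd_g D j) (row_mx (row_mx x1 x2) y))].

Definition K2_set D : set ('rV[R]_n1 * 'rV[R]_n2 * 'rV[R]_p) :=
  [set z | [/\ K1_set D z.1.1, Y_set D z.2 & stage2_feasible D z.1.1 z.2 z.1.2]].

(* Optimal values are infima in \bar R, so an infeasible problem has value +oo. *)
Definition vstar D (x1 : 'rV[R]_n1) (y : 'rV[R]_p) : \bar R :=
  ereal_inf [set (peval (rd_f2 D) (row_mx x1 x2))%:E | x2 in stage2_feasible D x1 y].

Definition stage1_cost D (phi : probability 'rV[R]_p R) (x1 : 'rV[R]_n1) : \bar R :=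
  ((peval (rd_f1 D) x1)%:E + \int[phi]_(y in Y_set D) vstar D x1 y)%E.

Definition rho D (phi : probability 'rV[R]_p R) : \bar R :=
  ereal_inf [set stage1_cost D phi x1 | x1 in K1_set D].

Definition two_stage_optimal D (phi : probability 'rV[R]_p R)
    (x1 : 'rV[R]_n1) : Prop :=
  K1_set D x1 /\ stage1_cost D phi x1 = rho D phi.

(* A finite Borel measure on the Borel set C is encoded as a finite Borel measure
   on the ambient space for which the complement of C is null. *)
Definition measure_on d (T : measurableType d) (C : set T)
    (mu : {finite_measure set T -> \bar R}) : Prop :=
  mu (~` C) = 0%E.

Definition proj_x1y D
    (mu2 : {finite_measure set ('rV[R]_n1 * 'rV[R]_n2 * 'rV[R]_p)%type -> \bar R})
    (B : set ('rV[R]_n1 * 'rV[R]_p)) : \bar R :=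
  mu2 [set z | K2_set D z /\ B (z.1.1, z.2)].

Definition gmp_feasible D (phi : probability 'rV[R]_p R)
    (mu1 : {finite_measure set 'rV[R]_n1 -> \bar R})
    (mu2 : {finite_measure set ('rV[R]_n1 * 'rV[R]_n2 * 'rV[R]_p)%type -> \bar R}) : Prop :=
  [/\ measure_on (K1_set D) mu1,
      measure_on (K2_set D) mu2,
      (\int[mu1]_(x1 in K1_set D) 1 = 1)%E &
      forall B : set ('rV[R]_n1 * 'rV[R]_p), measurable B ->
        B `<=` K1_set D `*` Y_set D ->
        proj_x1y D mu2 B = (mu1 \x phi)%E B].

Definition gmp_cost D
    (mu1 : {finite_measure set 'rV[R]_n1 -> \bar R})
    (mu2 : {finite_measure set ('rV[R]_n1 * 'rV[R]_n2 * 'rV[R]_p)%type -> \bar R}) : \bar R :=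
  (\int[mu1]_(x1 in K1_set D) (peval (rd_f1 D) x1)%:E +
   \int[mu2]_(z in K2_set D) (peval (rd_f2 D) (row_mx z.1.1 z.1.2))%:E)%E.

Definition rho12 D (phi : probability 'rV[R]_p R) : \bar R :=
  ereal_inf [set v | exists mu1 mu2,
    gmp_feasible D phi mu1 mu2 /\ v = gmp_cost D mu1 mu2].

Definition gmp_optimal D (phi : probability 'rV[R]_p R)
    (mu1 : {finite_measure set 'rV[R]_n1 -> \bar R})
    (mu2 : {finite_measure set ('rV[R]_n1 * 'rV[R]_n2 * 'rV[R]_p)%type -> \bar R}) : Prop :=
  gmp_feasible D phi mu1 mu2 /\ gmp_cost D mu1 mu2 = rho12 D phi.

End Problem.

(* Main.v *)
Require Import Defs.
From HB Require Import structures.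
From mathcomp Require Import all_boot all_order all_algebra.
From mathcomp Require Import all_classical all_reals all_analysis.
From mathcomp Require Import measurable_realfun.
Import numFieldNormedType.Exports.
Local Open Scope classical_set_scope.
Local Open Scope ring_scope.
Import Order.TTheory GRing.Theory Num.Theory.
Set Implicit Arguments.
Unset Strict Implicit.
Unset Printing Implicit Defensive.

(** Minimising over x2 pointwise and minimising over measures on the triples
    (x1, x2, y) give the same value, because a measurable choice of optimal recourse
    is available.

    Lower bound. Let (mu1, mu2) be feasible. On K2 the cost f2(x1, x2) is at least the
    optimal recourse cost v*(x1, y), which depends on (x1, y) only. Its integral
    against mu2 is therefore its integral against the marginal of mu2, which is the
    product of mu1 and phi, and Fubini's theorem turns the cost of (mu1, mu2) into at
    least the mu1-average of the first-stage objective over K1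
    ([integral_recourse_value], [rho_le_gmp_cost]). What has to be shown is that v* is
    measurable for the product sigma-algebra ([measurable_recourse_value]): its
    sublevel sets are projections of compact sets, and compact subsets of a product
    are measurable ([compact_measurable_rV2]).

    Upper bound. For x1 in K1 the pair made of the Dirac mass at x1 and the image of
    phi under y |-> (x1, s(y), y) is feasible and costs exactly the first-stage
    objective at x1, provided that s is Borel and s(y) is an optimal recourse for
    (x1, y) ([dirac_gmp]). Lexicographic minimisation provides such an s
    ([measurable_selection]): minimising a continuous function over
    compact sets that vary measurably gives compact sets that vary measurably
    ([measurable_argmin]), and minimising the coordinates one after the other
    leaves a single point.

    The two bounds give the equality of the values. If x1 attains the first optimal
    value, the pair of the upper bound attains the second one. *)

(** * Continuity and measurability of polynomial data *)

Lemma continuous_peval {T : topologicalType} {R : realType} {n : nat}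
    (P : mpoly.mpoly n R) (v : T -> 'rV[R]_n) :
  (forall i, continuous (fun t => v t 0 i)) ->
  continuous (fun t => peval P (v t)).
Proof.
move=> cv; rewrite /peval.
under eq_fun do rewrite mpoly.mevalE.
apply: continuous_big => [|m _]; first exact: add_continuous.
move=> t; apply: cvgM; first exact: cvg_cst.
move: t; apply: continuous_big => [|i _]; first exact: mul_continuous.
move=> t; apply: (@continuous_comp _ _ _ (fun t => v t 0 i) (fun x : R => x ^+ _)).
  exact: cv.
exact: exprn_continuous.
Qed.

Lemma measurable_peval {d : measure_display} {T : measurableType d}
    {R : realType} {n : nat} (P : mpoly.mpoly n R) (v : T -> 'rV[R]_n) :
  (forall i, measurable_fun setT (fun t => v t 0 i)) ->
  measurable_fun setT (fun t => peval P (v t)).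
Proof.
move=> mv; rewrite /peval.
under eq_fun do rewrite mpoly.mevalE.
apply: measurable_sum => m.
apply: measurable_funM => //.
apply: measurable_prod => i _.
exact: measurable_funX.
Qed.

Lemma measurable_fun_of_sublevel {d : measure_display} {T : measurableType d}
    {R : realType} (f : T -> R) :
  (forall c, measurable [set t | f t <= c]) -> measurable_fun setT f.
Proof.
move=> mf; apply: (measurability _ (RGenOInfty.measurableE R)).
move=> _ [_ [c ->] <-]; rewrite setTI.
rewrite (_ : _ @^-1` _ = ~` [set t | f t <= c]).
  exact: measurableC.
by apply/seteqP; split=> t /=; rewrite in_itv/= andbT ltNge => /negP.
Qed.

(** * Borel sets of row vectors and of pairs of row vectors *)

Section row_vectors.
Context {R : realType}.

Lemma open_measurable_rV {n : nat} (A : set 'rV[R]_n) : open A -> measurable A.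
Proof. exact: sub_sigma_algebra. Qed.

Lemma closed_measurable_rV {n : nat} (A : set 'rV[R]_n) : closed A -> measurable A.
Proof. by move=> /closed_openC/open_measurable_rV/measurableC; rewrite setCK. Qed.

Lemma compact_measurable_rV {n : nat} (A : set 'rV[R]_n) : compact A -> measurable A.
Proof.
by move=> cA; apply: closed_measurable_rV; apply: compact_closed cA; exact: norm_hausdorff.
Qed.

(** Closed sets generate the Borel sigma-algebra, so only their preimages matter;
    the selector constructed below is controlled exactly on closed sets. *)
Lemma measurable_fun_rV {d : measure_display} {T : measurableType d} {n : nat}
    (f : T -> 'rV[R]_n) :
  (forall F, closed F -> measurable (f @^-1` F)) -> measurable_fun setT f.
Proof.
move=> mf; apply: (@measurability _ _ _ _ _ _ (@open 'rV[R]_n)) => //.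
move=> _ [A oA <-]; rewrite setTI -[A]setCK -preimage_setC.
by apply: measurableC; apply: mf; exact: open_closedC.
Qed.

Lemma measurable_coord {n : nat} (i : 'I_n) :
  measurable_fun setT (fun x : 'rV[R]_n => x 0 i).
Proof.
apply: measurable_fun_of_sublevel => c; apply: closed_measurable_rV.
apply: (@preimage_closed _ _ (fun x : 'rV[R]_n => x 0 i) [set x | x <= c]).
  by move=> x _; exact: coord_continuous.
exact: closed_le.
Qed.

(** The sigma-algebra here is the product one, in which a closed set is not
    measurable by definition. A compact set is covered, for each k, by finitely
    many balls of radius 1/(k+1) centred in it; balls of the product are products of
    balls, so each cover is measurable, and the covers intersect to the closure. *)
Lemma compact_measurable_rV2 {m n : nat} (C : set ('rV[R]_m * 'rV[R]_n)) :
  compact C -> measurable C.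
Proof.
move=> cC.
have clC : closed C by apply: compact_closed cC; exact: norm_hausdorff.
have /choice[U HU] : forall k : nat, exists U : set ('rV[R]_m * 'rV[R]_n),
   [/\ measurable U, C `<=` U & forall z, U z -> exists2 c, C c & ball c k.+1%:R^-1 z].
  move=> k.
  have k0 : 0 < k.+1%:R^-1 :> R by rewrite invr_gt0.
  have cvC : @cover_compact ('rV[R]_m * 'rV[R]_n)%type C
    by have := cC; rewrite (compact_cover ('rV[R]_m * 'rV[R]_n : normedModType R)%type).
  case: (cvC _ C (fun c => ball c k.+1%:R^-1)).
  - by move=> c _; exact: ball_open.
  - by move=> c Cc; exists c => //; exact: ballxx.
  move=> F FC; set U := cover _ _ => CF; exists U; split => //.
    apply: fin_bigcup_measurable => // c _.
    rewrite (_ : ball c _ = ball c.1 k.+1%:R^-1 `*` ball c.2 k.+1%:R^-1) //.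
    by apply: measurableX; apply: open_measurable_rV; exact: ball_open.
  by move=> z [c /= /FC]; rewrite inE => Cc cz; exists c.
rewrite (_ : C = \bigcap_k U k).
  by apply: bigcapT_measurable => k; have [] := HU k.
apply/seteqP; split=> [z Cz k _|z Uz].
  by have [_ + _] := HU k; exact.
apply: clC => B /nbhs_ballP[e /= e0 zeB].
have [k _ /(_ k (leqnn k)) ke] := near_infty_natSinv_lt (PosNum e0).
have [_ _ /(_ z (Uz k I))[c Cc cz]] := HU k.
by exists c; split => //; apply/zeB/ball_sym; exact: le_ball (ltW ke) _ cz.
Qed.

End row_vectors.

(** * Lexicographic minimisation and measurable selection *)

Section argmin.
Context {X : topologicalType} {R : realType}.
Implicit Types (A : set X) (f : X -> R).

Definition argmin f A : set X := A `&` [set x | forall x', A x' -> f x <= f x'].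

Lemma argmin_sub f A : argmin f A `<=` A.
Proof. by move=> x []. Qed.

Lemma argmin_nonempty f A :
  continuous f -> compact A -> A !=set0 -> argmin f A !=set0.
Proof.
move=> cf cA A0.
have [c cA' cmin] := compact_EVT_min A0 cA (continuous_subspaceT cf).
by exists c; split; [exact: set_mem|move=> x Ax; apply: cmin; exact: mem_set].
Qed.

Lemma closed_sublevel f c : continuous f -> closed [set x | f x <= c].
Proof.
move=> cf; apply: (@preimage_closed _ _ f [set y | y <= c]); last exact: closed_le.
by move=> x _; exact: cf.
Qed.

Lemma argmin_compact f A : continuous f -> compact A -> compact (argmin f A).
Proof.
move=> cf cA; apply: compact_closedI => //.
(* The set of minimisers is cut out of [A] by closed sublevel sets. *)
rewrite (_ : [set _ | _] = \bigcap_(x' in A) [set x | f x <= f x']).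
  by apply: closed_bigI => x' _; exact: closed_sublevel.
by apply/seteqP; split=> x /= H x'; exact: H.
Qed.

Lemma argmin_eq f A x x' : argmin f A x -> argmin f A x' -> f x = f x'.
Proof. by move=> [Ax lex] [Ax' lex']; apply/le_anti; rewrite lex// lex'. Qed.

(** [foldr] makes the last criterion of [s] the first one to be minimised. *)
Definition lexmin {I : Type} (c : I -> X -> R) (s : seq I) (A : set X) : set X :=
  foldr (fun i B => argmin (c i) B) A s.

Lemma lexmin_sub {I : Type} (c : I -> X -> R) (s : seq I) A : lexmin c s A `<=` A.
Proof. by elim: s => //= i s IH x /argmin_sub /IH. Qed.

Lemma lexmin_nonempty {I : Type} (c : I -> X -> R) (s : seq I) A :
  (forall i, continuous (c i)) -> compact A -> A !=set0 ->
  compact (lexmin c s A) /\ lexmin c s A !=set0.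
Proof.
move=> cc cA A0; elim: s => //= i s [cB B0]; split; first exact: argmin_compact.
exact: argmin_nonempty.
Qed.

Lemma lexmin_eq {I : eqType} (c : I -> X -> R) (s : seq I) A x x' :
  lexmin c s A x -> lexmin c s A x' ->
  {in s, forall i, c i x = c i x'}.
Proof.
elim: s => //= j s IH xA x'A i; rewrite inE => /predU1P[->|].
  exact: argmin_eq xA x'A.
by apply: IH; [exact: argmin_sub xA|exact: argmin_sub x'A].
Qed.

End argmin.

Section selection.
Context {d : measure_display} {T : measurableType d} {X : topologicalType}
  {R : realType}.
Implicit Types G : T -> set X.

(** Weak measurability of a multifunction, tested on closed rather than open sets:
    with compact values this form passes to sets of minimisers. *)
Definition measurable_compact_valued G :=
  (forall t, compact (G t)) /\
  (forall F, closed F -> measurable [set t | G t `&` F !=set0]).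

(** The minimisers over [G t] meet a closed [F] exactly when [G t] meets [F] and the
    minimum over [G t `&` F] does not exceed the minimum over [G t]. Failure of the
    latter is witnessed by a rational q between the two minima: [G t] meets the
    sublevel set of q, while [G t `&` F] does not. Only closed sets occur in this
    description, and only countably many of them. *)
Lemma measurable_argmin (f : X -> R) G : continuous f ->
  measurable_compact_valued G -> measurable_compact_valued (fun t => argmin f (G t)).
Proof.
move=> cf [cG mG]; split=> [t|F cF]; first exact: argmin_compact.
rewrite (_ : [set t | _] = [set t | G t `&` F !=set0] `\`
   \bigcup_(q : rat) ([set t | G t `&` [set x | f x <= ratr q] !=set0] `\`
     [set t | G t `&` (F `&` [set x | f x <= ratr q]) !=set0])).
  apply: measurableD; first exact: mG.
  apply: bigcupT_measurable_rat => q.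
  have cq := @closed_sublevel _ _ f (ratr q) cf.
  by apply: measurableD; apply: mG => //; exact: closedI.
apply/seteqP; split=> t /=.
  move=> [x [[Gx xmin] Fx]]; split; first by exists x.
  move=> [q _ [[x' [Gx' /= x'q]]]]; apply.
  by exists x; split => //; split => //=; exact: le_trans (xmin _ Gx') x'q.
move=> [GF0 noq].
have [x [[Gx Fx] xmin]] := argmin_nonempty cf (compact_closedI (cG t) cF) GF0.
exists x; split => //; split => // x' Gx'; rewrite leNgt; apply/negP => x'x.
have [q] := rat_in_itvoo x'x; rewrite in_itv/= => /andP[x'q qx].
apply: noq; exists q => //; split; first by exists x'; split => //=; exact: ltW.
move=> [z [Gz [Fz /= zq]]].
by have := le_lt_trans zq qx; rewrite ltNge xmin.
Qed.

Lemma measurable_lexmin {I : Type} (c : I -> X -> R) (s : seq I) G :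
  (forall i, continuous (c i)) -> measurable_compact_valued G ->
  measurable_compact_valued (fun t => lexmin c s (G t)).
Proof. by move=> cc mG; elim: s => //= i s IH; exact: measurable_argmin. Qed.

(** Among the minimisers of [f], ties are broken by minimising in turn the
    functions [c i]. As these separate points, a single point survives, and the
    multifunction of survivors is a function whose preimages of closed sets are
    measurable. [x0] is the value taken where [G t] is empty. *)
Lemma measurable_selection {I : finType} (c : I -> X -> R) (x0 : X) (f : X -> R) G :
  (forall i, continuous (c i)) ->
  (forall x x', (forall i, c i x = c i x') -> x = x') ->
  continuous f -> measurable_compact_valued G ->
  exists s : T -> X, (forall F, closed F -> measurable (s @^-1` F)) /\
    (forall t, G t !=set0 -> argmin f (G t) (s t)).
Proof.
move=> cc sep cf mG.
pose H t := lexmin c (enum I) (argmin f (G t)).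
have [cH mH] : measurable_compact_valued H.
  by apply: measurable_lexmin => //; exact: measurable_argmin.
have H0 t : G t !=set0 -> H t !=set0.
  move=> G0; apply: (proj2 (lexmin_nonempty _ cc _ _)).
    by apply: argmin_compact => //; exact: (proj1 mG).
  by apply: argmin_nonempty => //; exact: (proj1 mG).
have Heq t x x' : H t x -> H t x' -> x = x'.
  move=> Hx Hx'; apply: sep => i.
  by apply: (lexmin_eq Hx Hx'); rewrite mem_enum.
exists (fun t => xget x0 (H t)); split; last first.
  move=> t /H0[x Hx]; apply: (@lexmin_sub _ _ _ c (enum I)).
  by apply: xgetPex; exists x.
move=> F cF.
rewrite (_ : _ @^-1` F = [set t | H t `&` F !=set0] `|`
   (~` [set t | H t `&` setT !=set0] `&` [set _ | F x0])).
  apply: measurableU; first exact: mH.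
  apply: measurableI.
    by apply: measurableC; apply: mH; exact: closedT.
  have [Fx0|nFx0] := pselect (F x0).
    by rewrite (_ : [set _ | _] = setT)//; apply/seteqP; split.
  by rewrite (_ : [set _ | _] = set0)//; apply/seteqP; split.
apply/seteqP; split=> t /=.
  case: xgetP => [x _ Hx Fx|nH Fx0]; first by left; exists x.
  by right; split => // -[x [/nH]].
case=> [[x [Hx Fx]]|[nH Fx0]].
  by rewrite (Heq t (xget x0 (H t)) x)//; apply: xgetPex; exists x.
rewrite xgetPN // => x Hx; apply: nH; exists x; split => //.
Qed.

End selection.

(** * Auxiliary facts on coordinates, boundedness and null sets *)

Section row_mx_coordinates.
Context {R : realType} {m n : nat}.

Lemma continuous_row_mx_coord {T : topologicalType} (u : T -> 'rV[R]_m) (v : T -> 'rV[R]_n) :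
  (forall i, continuous (fun t => u t 0 i)) ->
  (forall i, continuous (fun t => v t 0 i)) ->
  forall i, continuous (fun t => row_mx (u t) (v t) 0 i).
Proof.
move=> cu cv i; under eq_fun do rewrite mxE.
by case: (fintype.split i) => j; [exact: cu|exact: cv].
Qed.

Lemma measurable_row_mx_coord {d : measure_display} {T : measurableType d}
    (u : T -> 'rV[R]_m) (v : T -> 'rV[R]_n) :
  (forall i, measurable_fun setT (fun t => u t 0 i)) ->
  (forall i, measurable_fun setT (fun t => v t 0 i)) ->
  forall i, measurable_fun setT (fun t => row_mx (u t) (v t) 0 i).
Proof.
move=> cu cv i; under eq_fun do rewrite mxE.
by case: (fintype.split i) => j; [exact: cu|exact: cv].
Qed.

End row_mx_coordinates.

Lemma continuous_fst {X Y : topologicalType} : continuous (@fst X Y).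
Proof. by move=> x; exact: cvg_fst. Qed.

Lemma continuous_snd {X Y : topologicalType} : continuous (@snd X Y).
Proof. by move=> x; exact: cvg_snd. Qed.

Lemma continuous_coord_comp {R : realType} {T : topologicalType} {n : nat}
    (u : T -> 'rV[R]_n) (i : 'I_n) :
  continuous u -> continuous (fun t => u t 0 i).
Proof.
move=> cu t; apply: (@continuous_comp _ _ _ u (fun x : 'rV[R]_n => x 0 i)).
  exact: cu.
exact: coord_continuous.
Qed.

Lemma measurable_coord_comp {R : realType} {d : measure_display} {T : measurableType d}
    {n : nat} (u : T -> 'rV[R]_n) (i : 'I_n) :
  measurable_fun setT u -> measurable_fun setT (fun t => u t 0 i).
Proof. by move=> mu; exact: (measurableT_comp (measurable_coord i) mu). Qed.

Lemma integrable_of_bounded {d : measure_display} {T : measurableType d} {R : realType}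
    (mu : {measure set T -> \bar R}) (A : set T) (f : T -> R) (M : R) :
  measurable A -> (mu A < +oo)%E -> measurable_fun setT f ->
  (forall x, A x -> `|f x| <= M) -> mu.-integrable A (EFin \o f).
Proof.
move=> mA muA mf fM; apply: measurable_bounded_integrable => //.
  exact: measurable_funTS.
exists M; split; first exact: num_real.
by move=> y My x Ax; apply: le_trans (ltW My); exact: fM.
Qed.

Lemma compact_bounded_fun {T : topologicalType} {R : realType} (f : T -> R) (A : set T) :
  compact A -> continuous f -> exists M, forall x, A x -> `|f x| <= M.
Proof.
move=> cA cf; have [->|/set0P A0] := eqVneq A set0; first by exists 0.
have cnf : continuous (fun x => `|f x|).
  by move=> x; apply: cvg_norm; exact: cf.
have [c _ cmax] := compact_EVT_max A0 cA (continuous_subspaceT cnf).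
by exists `|f c| => x Ax; apply: cmax; exact: mem_set.
Qed.

Lemma measure_setI_conull {d : measure_display} {T : measurableType d} {R : realType}
    (mu : {measure set T -> \bar R}) (K A : set T) :
  measurable K -> measurable A -> mu (~` K) = 0%E -> mu A = mu (A `&` K).
Proof.
move=> mK mA K0; rewrite (measureDI mu mA mK).
rewrite (@subset_measure0 _ _ _ mu (A `\` K) (~` K)) ?add0e//.
- exact: measurableD.
- exact: measurableC.
Qed.

(** * The recourse problem and its value function *)

Section problem.
Context {R : realType} {n1 n2 p Nq Nh Ng Ng' : nat}.
Context (D : recourse_data R n1 n2 p Nq Nh Ng Ng').
Local Notation K1 := (K1_set D).
Local Notation Y := (Y_set D).
Local Notation K2 := (K2_set D).
Local Notation X1 := 'rV[R]_n1.
Local Notation X2 := 'rV[R]_n2.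
Local Notation XY := 'rV[R]_p.

Definition second_cost (x1 : X1) (x2 : X2) : R := peval (rd_f2 D) (row_mx x1 x2).
Definition joint_cost (z : X1 * X2 * XY) : R := second_cost z.1.1 z.1.2.

(** The map behind the projection of measures on [K2] to measures on [K1 `*` Y]. *)
Definition drop_x2 (z : X1 * X2 * XY) : X1 * XY := (z.1.1, z.2).

Lemma continuous_x1 : continuous (fun z : X1 * X2 * XY => z.1.1).
Proof. by move=> z; apply: (@continuous_comp _ _ _ fst fst); exact: continuous_fst. Qed.

Lemma continuous_x2 : continuous (fun z : X1 * X2 * XY => z.1.2).
Proof.
by move=> z; apply: (@continuous_comp _ _ _ fst snd);
  [exact: continuous_fst|exact: continuous_snd].
Qed.

Lemma continuous_drop_x2 : continuous drop_x2.
Proof.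
move=> z; apply: (@cvg_pair _ _ _ (nbhs z) (nbhs z.1.1) (nbhs z.2) _ _ _
  (fun z => z.1.1) (fun z => z.2)).
  exact: continuous_x1.
exact: continuous_snd.
Qed.

Lemma measurable_x1 : measurable_fun setT (fun z : X1 * X2 * XY => z.1.1).
Proof. exact: (measurableT_comp measurable_fst measurable_fst). Qed.

Lemma measurable_x2 : measurable_fun setT (fun z : X1 * X2 * XY => z.1.2).
Proof. exact: (measurableT_comp measurable_snd measurable_fst). Qed.

Lemma measurable_drop_x2 : measurable_fun setT drop_x2.
Proof. by apply: measurable_fun_pair; [exact: measurable_x1|exact: measurable_snd]. Qed.

Lemma continuous_joint_cost : continuous joint_cost.
Proof.
apply: (@continuous_peval _ _ _ _ (fun z : X1 * X2 * XY => row_mx z.1.1 z.1.2)).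
apply: continuous_row_mx_coord => i; apply: continuous_coord_comp.
  exact: continuous_x1.
exact: continuous_x2.
Qed.

Lemma continuous_second_cost x1 : continuous (second_cost x1).
Proof.
apply: (@continuous_peval _ _ _ _ (fun x2 => row_mx x1 x2)).
by apply: continuous_row_mx_coord => i; [exact: cst_continuous|exact: coord_continuous].
Qed.

Lemma measurable_joint_cost : measurable_fun setT joint_cost.
Proof.
apply: measurable_peval; apply: measurable_row_mx_coord => i; apply: measurable_coord_comp.
  exact: measurable_x1.
exact: measurable_x2.
Qed.

Lemma measurable_constraint (P : mpoly.mpoly (n1 + n2 + p) R) :
  measurable_fun setT (fun z : X1 * X2 * XY => peval P (row_mx (row_mx z.1.1 z.1.2) z.2)).
Proof.
apply: measurable_peval.
apply: (@measurable_row_mx_coord _ _ _ _ _ (fun z : X1 * X2 * XY => row_mx z.1.1 z.1.2) snd).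
  apply: measurable_row_mx_coord => i.
    exact: (measurable_coord_comp (u := fun z : X1 * X2 * XY => z.1.1) i measurable_x1).
  exact: (measurable_coord_comp (u := fun z : X1 * X2 * XY => z.1.2) i measurable_x2).
by move=> i; exact: (measurable_coord_comp (u := snd) i measurable_snd).
Qed.

Lemma measurable_K2 : compact K1 -> compact Y -> measurable K2.
Proof.
move=> cK1 cY.
rewrite (_ : K2 = ((fun z : X1 * X2 * XY => z.1.1) @^-1` K1 `&` snd @^-1` Y) `&`
  ((\bigcap_(i in [set: 'I_Nh])
     ((fun z : X1 * X2 * XY => peval (rd_h D i) (row_mx (row_mx z.1.1 z.1.2) z.2)) @^-1`
        [set 0])) `&`
   (\bigcap_(j in [set: 'I_Ng])
     ((fun z : X1 * X2 * XY => peval (rd_g D j) (row_mx (row_mx z.1.1 z.1.2) z.2)) @^-1`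
        `[0, +oo[)))).
  apply: measurableI.
    apply: measurableI; rewrite -[X in measurable X]setTI.
      by apply: measurable_x1 => //; exact: compact_measurable_rV.
    by apply: measurable_snd => //; exact: compact_measurable_rV.
  apply: measurableI; apply: fin_bigcap_measurable => // i _;
    rewrite -[X in measurable X]setTI; exact: measurable_constraint.
apply/seteqP; split=> z /=.
  move=> [K1z Yz [hz gz]]; split => //; split => i _ //=.
  by rewrite in_itv/= andbT.
move=> [[K1z Yz] [hz gz]]; split => //; split => i; first exact: hz.
by have := gz i I; rewrite /= in_itv/= andbT.
Qed.

Definition feasible_recourse (x1 : X1) (y : XY) : set X2 := [set x2 | K2 (x1, x2, y)].

Lemma closed_slice (x1 : X1) : closed [set z : X1 * X2 * XY | z.1.1 = x1].
Proof.
apply: (@preimage_closed _ _ (fun z : X1 * X2 * XY => z.1.1) [set x1]).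
  by move=> z _; exact: continuous_x1.
by apply: compact_closed; [exact: norm_hausdorff|exact: compact_set1].
Qed.

(** The parameters [y] whose feasible set meets a closed [F] form the projection of
    a compact subset of [K2]. *)
Lemma measurable_feasible_recourse (x1 : X1) : compact K2 ->
  measurable_compact_valued (feasible_recourse x1).
Proof.
move=> cK2; split=> [y|F cF].
  rewrite (_ : feasible_recourse x1 y = (fun z => z.1.2) @`
      (K2 `&` ([set z | z.1.1 = x1] `&` [set z | z.2 = y]))).
    apply: continuous_compact; first exact/continuous_subspaceT/continuous_x2.
    apply: compact_closedI => //; apply: closedI; first exact: closed_slice.
    apply: (@preimage_closed _ _ snd [set y]); first by move=> z _; exact: continuous_snd.
    by apply: compact_closed; [exact: norm_hausdorff|exact: compact_set1].
  apply/seteqP; split=> [x2 x2K|x2 [[[z1 z2] z3] /= [K2z [<- <-]] <-]] //.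
  by exists (x1, x2, y).
apply: compact_measurable_rV.
rewrite (_ : [set y | _] = snd @`
    (K2 `&` ([set z | z.1.1 = x1] `&` (fun z => z.1.2) @^-1` F))).
  apply: continuous_compact; first by apply: continuous_subspaceT; exact: continuous_snd.
  apply: compact_closedI => //; apply: closedI; first exact: closed_slice.
  by apply: preimage_closed => // z _; exact: continuous_x2.
apply/seteqP; split=> [y [x2 [K2z Fx2]]|y [[[z1 z2] z3] /= [K2z [<- Fz]] <-]].
  by exists (x1, x2, y).
by exists z2.
Qed.

Lemma vstar_argmin x1 y x2 : K1 x1 -> Y y ->
  argmin (second_cost x1) (feasible_recourse x1 y) x2 ->
  vstar D x1 y = (second_cost x1 x2)%:E.
Proof.
move=> K1x1 Yy [[_ _ feas] x2min]; apply/le_anti/andP; split.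
  by apply: ereal_inf_lbound; exists x2.
apply: le_ereal_inf_tmp => _ [x2' feas' <-].
by rewrite lee_fin; apply: x2min; split.
Qed.

(** The optimal second-stage cost, made real-valued and total by the value 0 outside
    [K1 `*` Y], so that it can be integrated over the whole space. *)
Definition recourse_value (xy : X1 * XY) : R :=
  if pselect ((K1 `*` Y) xy) then fine (vstar D xy.1 xy.2) else 0.

Lemma recourse_value_out xy : ~ (K1 `*` Y) xy -> recourse_value xy = 0.
Proof. by rewrite /recourse_value; case: pselect. Qed.

Context (cK1 : compact K1) (cK2 : compact K2) (cY : compact Y).
Context (recourse : forall (x1 : X1) (y : XY), K1 x1 -> Y y ->
  exists x2 : X2, K2 (x1, x2, y)).

Lemma optimal_recourse_exists x1 y : K1 x1 -> Y y ->
  exists x2, argmin (second_cost x1) (feasible_recourse x1 y) x2.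
Proof.
move=> K1x1 Yy; have [cF _] := measurable_feasible_recourse x1 cK2.
exact: argmin_nonempty (@continuous_second_cost x1) (cF y) (recourse K1x1 Yy).
Qed.

Lemma recourse_value_vstar x1 y : K1 x1 -> Y y ->
  vstar D x1 y = (recourse_value (x1, y))%:E.
Proof.
move=> K1x1 Yy; have [x2 x2min] := optimal_recourse_exists K1x1 Yy.
have vE := vstar_argmin K1x1 Yy x2min.
rewrite /recourse_value; case: pselect => [_ /=|[]]; last by split.
by rewrite vE.
Qed.

Lemma recourse_value_argmin x1 y x2 : K1 x1 -> Y y ->
  argmin (second_cost x1) (feasible_recourse x1 y) x2 ->
  recourse_value (x1, y) = second_cost x1 x2.
Proof.
move=> K1x1 Yy x2min; have := vstar_argmin K1x1 Yy x2min.
by rewrite recourse_value_vstar// => -[].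
Qed.

Lemma recourse_value_attained x1 y : K1 x1 -> Y y ->
  exists2 x2, K2 (x1, x2, y) & recourse_value (x1, y) = second_cost x1 x2.
Proof.
move=> K1x1 Yy; have [x2 x2min] := optimal_recourse_exists K1x1 Yy.
by exists x2; [case: x2min|exact: recourse_value_argmin].
Qed.

Lemma recourse_value_le z : K2 z -> recourse_value (drop_x2 z) <= joint_cost z.
Proof.
move=> K2z; have [K1z Yz feas] := K2z.
rewrite -lee_fin -recourse_value_vstar//.
by apply: ereal_inf_lbound; exists z.1.2.
Qed.

Lemma cost_bounded : exists M, (forall z, K2 z -> `|joint_cost z| <= M) /\
  (forall xy, `|recourse_value xy| <= M).
Proof.
have [M HM] := compact_bounded_fun cK2 continuous_joint_cost.
(* The maximum with 0 covers an empty [K2], where [M] may be negative. *)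
exists (Num.max 0 M); split=> [z K2z|[x1 y]].
  by rewrite le_max HM ?orbT.
have [[K1x1 Yy]|out] := pselect ((K1 `*` Y) (x1, y)); last first.
  by rewrite recourse_value_out// normr0 le_max lexx.
have [x2 K2z ->] := recourse_value_attained K1x1 Yy.
by rewrite le_max (HM _ K2z) orbT.
Qed.

(** As the minimum is attained, a sublevel set inside [K1 `*` Y] is the projection of
    the compact set of points of [K2] whose cost is at most [c]. *)
Lemma measurable_recourse_value : measurable_fun setT recourse_value.
Proof.
apply: measurable_fun_of_sublevel => c.
rewrite (_ : [set xy | _] = drop_x2 @` (K2 `&` [set z | joint_cost z <= c]) `|`
   (~` (K1 `*` Y) `&` [set _ | 0 <= c])).
  apply: measurableU.
    apply: compact_measurable_rV2; apply: continuous_compact.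
      by apply: continuous_subspaceT; exact: continuous_drop_x2.
    apply: compact_closedI => //; apply: closed_sublevel.
    exact: continuous_joint_cost.
  apply: measurableI.
    by apply: measurableC; apply: measurableX; exact: compact_measurable_rV.
  have [c0|c0] := boolP (0 <= c).
    by rewrite (_ : [set _ | _] = setT)//; apply/seteqP; split.
  by rewrite (_ : [set _ | _] = set0)//; apply/seteqP; split=> // x /= /negP; rewrite c0.
apply/seteqP; split=> [[x1 y]|xy] /=.
  have [[K1x1 Yy]|out] := pselect ((K1 `*` Y) (x1, y)).
    have [x2 K2z ->] := recourse_value_attained K1x1 Yy => zc.
    by left; exists (x1, x2, y).
  by rewrite recourse_value_out// => c0; right.
case=> [[z [K2z zc] <-]|[out c0]]; last by rewrite recourse_value_out.
exact: le_trans (recourse_value_le K2z) zc.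
Qed.

Context (phi : probability 'rV[R]_p R) (phiY : phi Y = 1%E).

Let mK1 : measurable K1. Proof. exact: compact_measurable_rV. Qed.
Let mY : measurable Y. Proof. exact: compact_measurable_rV. Qed.
Let mK2 : measurable K2. Proof. exact: measurable_K2. Qed.

Lemma phi_notY : phi (~` Y) = 0%E.
Proof. by rewrite probability_setC// phiY subee. Qed.

Let mw_slice x1 : measurable_fun setT (fun y => recourse_value (x1, y)).
Proof.
apply: (measurableT_comp measurable_recourse_value).
by apply: measurable_fun_pair.
Qed.

Lemma integrable_recourse_value x1 :
  phi.-integrable setT (EFin \o (fun y => recourse_value (x1, y))).
Proof.
have [M [_ wM]] := cost_bounded.
apply: (@integrable_of_bounded _ _ _ _ _ _ M) => //.
exact: le_lt_trans (probability_le1 phi measurableT) (ltry 1).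
Qed.

Lemma expected_recourse x1 : K1 x1 ->
  (\int[phi]_(y in Y) vstar D x1 y = \int[phi]_y (recourse_value (x1, y))%:E)%E.
Proof.
move=> K1x1.
transitivity (\int[phi]_(y in Y) (recourse_value (x1, y))%:E)%E.
  by apply: eq_integral => y /set_mem Yy; exact: recourse_value_vstar.
rewrite [RHS](negligible_integral (N := ~` Y)) => //.
- by rewrite setTD setCK.
- exact: measurableC.
- exact: integrable_recourse_value.
- exact: phi_notY.
Qed.

Lemma continuous_first_cost : continuous (peval (rd_f1 D)).
Proof. by apply: (@continuous_peval _ _ _ _ id) => i; exact: coord_continuous. Qed.

Lemma measurable_first_cost : measurable_fun setT (peval (rd_f1 D)).
Proof. by apply: (@measurable_peval _ _ _ _ _ id) => i; exact: measurable_coord. Qed.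

(** * Both inequalities between the two optimal values *)

Definition expected_cost (x1 : X1) : \bar R :=
  ((peval (rd_f1 D) x1)%:E + \int[phi]_y (recourse_value (x1, y))%:E)%E.

Lemma stage1_costE x1 : K1 x1 -> stage1_cost D phi x1 = expected_cost x1.
Proof. by move=> K1x1; rewrite /stage1_cost expected_recourse. Qed.

Lemma stage1_cost_fin_num x1 : K1 x1 -> stage1_cost D phi x1 \is a fin_num.
Proof.
move=> K1x1; rewrite stage1_costE// fin_numD /=.
apply: integrable_fin_num => //; exact: integrable_recourse_value.
Qed.

Section lower_bound.
Context (mu1 : {finite_measure set X1 -> \bar R})
  (mu2 : {finite_measure set (X1 * X2 * XY)%type -> \bar R}).
Context (feas : gmp_feasible D phi mu1 mu2).

(** The marginal constraint only speaks of Borel subsets of [K1 `*` Y]; it extends to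
    all Borel sets since both measures vanish off [K1 `*` Y]. *)
Lemma pushforward_drop_x2 (B : set (X1 * XY)) : measurable B ->
  pushforward mu2 drop_x2 B = (mu1 \x phi)%E B.
Proof.
move=> mB; have [mu1K mu2K _ proj] := feas.
have mKY : measurable (K1 `*` Y) by exact: measurableX.
have mpB : measurable (drop_x2 @^-1` B : set (X1 * X2 * XY)).
  by rewrite -[X in measurable X]setTI; exact: measurable_drop_x2.
have -> : pushforward mu2 drop_x2 B = proj_x1y D mu2 (B `&` (K1 `*` Y)).
  rewrite /pushforward /proj_x1y.
  rewrite (measure_setI_conull mK2 mpB mu2K); congr (mu2 _).
  apply/seteqP; split=> [z [Bz K2z]|z [K2z [Bz _]]] //.
  by have [K1z Yz _] := K2z; split.
rewrite proj; [|exact: measurableI|by move=> xy []].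
apply/esym/(measure_setI_conull (mu := (mu1 \x phi)%E)) => //.
rewrite (_ : ~` _ = (~` K1 `*` setT) `|` (setT `*` ~` Y)); last first.
  apply/seteqP; split=> [[x1 y] /= nKY|[x1 y] /=].
    have [K1x1|nK1] := pselect (K1 x1); last by left.
    by right; split => // Yy; apply: nKY.
  by move=> [[nK1 _] []//|[_ nY] []].
apply/eqP; rewrite -measure_le0.
apply: le_trans (measureU2 _ _ _) _.
- by apply: measurableX => //; exact: measurableC.
- by apply: measurableX => //; exact: measurableC.
rewrite /= !product_measure1E//; [|exact: measurableC|exact: measurableC].
by rewrite [X in (_ * _ + _ * X)%E]phi_notY mule0 [X in (X * _)%E]mu1K mul0e adde0.
Qed.

Let integrable_prod : (mu1 \x phi)%E.-integrable setT (EFin \o recourse_value).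
Proof.
have [M [_ wM]] := cost_bounded.
have fin_prod : ((mu1 \x phi) (setT `*` setT) < +oo)%E.
  by rewrite product_measure1E// [X in (_ * X)%E]probability_setT mule1 ltey_eq fin_num_measure.
rewrite setXTT in fin_prod.
apply: (@integrable_of_bounded _ _ _ (mu1 \x phi)%E _ _ M) => //.
exact: measurable_recourse_value.
Qed.

Let integrable_drop (A : set (X1 * X2 * XY)) : measurable A ->
  mu2.-integrable A (EFin \o (recourse_value \o drop_x2)).
Proof.
move=> mA; have [M [_ wM]] := cost_bounded.
apply: (@integrable_of_bounded _ _ _ _ _ _ M) => //.
- by rewrite ltey_eq fin_num_measure.
- exact: (measurableT_comp measurable_recourse_value measurable_drop_x2).
- by move=> z _; exact: wM.
Qed.

Let integrable_expected :
  mu1.-integrable setT (fun x1 => \int[phi]_y (recourse_value (x1, y))%:E)%E.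
Proof. exact: (integrable_fubini_F integrable_prod). Qed.

(** A function of (x1, y) alone is integrated against [mu2] through its marginal
    [mu1 \x phi], to which Fubini applies. *)
Lemma integral_recourse_value :
  (\int[mu2]_(z in K2) (recourse_value (drop_x2 z))%:E =
   \int[mu1]_(x1 in K1) \int[phi]_y (recourse_value (x1, y))%:E)%E.
Proof.
have [mu1K mu2K _ _] := feas.
transitivity (\int[mu2]_z (recourse_value (drop_x2 z))%:E)%E.
  rewrite [RHS](negligible_integral (N := ~` K2))//.
  - by rewrite setTD setCK.
  - exact: measurableC.
  - exact: integrable_drop.
transitivity (\int[pushforward mu2 drop_x2]_xy (recourse_value xy)%:E)%E.
  rewrite integral_pushforward//.
  - exact: measurable_drop_x2.
  - by apply/measurable_EFinP; exact: measurable_recourse_value.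
  - by rewrite preimage_setT; exact: integrable_drop.
transitivity (\int[mu1 \x phi]_xy (recourse_value xy)%:E)%E.
  apply: (eq_measure_integral (mu1 \x phi)%E) => [|mf B mB _].
    exact: measurable_drop_x2.
  exact: pushforward_drop_x2.
rewrite -(integral12_prod_meas1 integrable_prod).
rewrite (negligible_integral (N := ~` K1))//.
- by rewrite setTD setCK.
- exact: measurableC.
Qed.

(** On [K2] the cost dominates the optimal recourse cost, so the cost of the pair is
    at least the [mu1]-average of the first-stage costs, and [mu1] is a probability
    on [K1]. *)
Lemma rho_le_gmp_cost : (rho D phi <= gmp_cost D mu1 mu2)%E.
Proof.
have [mu1K mu2K mass _] := feas.
have fin_mu1 : (mu1 K1 < +oo)%E by rewrite ltey_eq fin_num_measure.
have fin_mu2 : (mu2 K2 < +oo)%E by rewrite ltey_eq fin_num_measure.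
have [M1 f1M] := compact_bounded_fun cK1 continuous_first_cost.
have if1 := integrable_of_bounded mK1 fin_mu1 measurable_first_cost f1M.
have iE : mu1.-integrable K1 (fun x1 => \int[phi]_y (recourse_value (x1, y))%:E)%E.
  exact: integrableS integrable_expected.
have [M [f2M _]] := cost_bounded.
have if2 := integrable_of_bounded mK2 fin_mu2 measurable_joint_cost f2M.
apply: (@le_trans _ _ (\int[mu1]_(x1 in K1) expected_cost x1)%E); last first.
  rewrite integralD// leeD2l// -integral_recourse_value.
  apply: le_integral => //; first exact: integrable_drop.
  by move=> z /set_mem K2z; rewrite lee_fin; exact: recourse_value_le.
(* [rho] is not +oo: [mu1] has mass 1, so [K1] is nonempty, and stage costs are
   finite. *)
have [x0 K1x0] : K1 !=set0.
  apply/set0P/eqP => K10; move: mass; rewrite K10 integral_set0.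
  by move=> /esym/eqP; rewrite onee_eq0.
have rho_lb x1 : K1 x1 -> (rho D phi <= expected_cost x1)%E.
  by move=> K1x1; rewrite -stage1_costE//; apply: ereal_inf_lbound; exists x1.
have : (rho D phi < +oo)%E.
  apply: le_lt_trans (rho_lb _ K1x0) _.
  by rewrite ltey_eq -stage1_costE// stage1_cost_fin_num.
case: (rho D phi) rho_lb => [r| |] // rho_lb _; last by rewrite leNye.
have <- : (\int[mu1]_(x1 in K1) cst r%:E x1 = r%:E)%E.
  rewrite [LHS]integral_cst//.
  by move: mass; rewrite [X in X = _]integral_cst// mul1e => ->; rewrite mule1.
apply: le_integral => //.
- exact: finite_measure_integrable_cst.
- exact: integrableD.
- by move=> x1 /set_mem K1x1; exact: rho_lb.
Qed.

End lower_bound.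

Section upper_bound.
Context (x1 : X1) (K1x1 : K1 x1).

(** The second measure is the law of (x1, s y, y), where y has law [phi] and [s] is a
    Borel selection of optimal recourse decisions. *)
Lemma dirac_gmp : exists mu2 : {finite_measure set (X1 * X2 * XY)%type -> \bar R},
  gmp_feasible D phi \d_x1 mu2 /\ gmp_cost D \d_x1 mu2 = stage1_cost D phi x1.
Proof.
have [s [ms smin]] : exists s : XY -> X2, (forall F, closed F -> measurable (s @^-1` F)) /\
    (forall y, feasible_recourse x1 y !=set0 ->
       argmin (second_cost x1) (feasible_recourse x1 y) (s y)).
  apply: (@measurable_selection _ _ _ _ 'I_n2 (fun i (x : X2) => x 0 i) 0).
  - by move=> i; exact: coord_continuous.
  - by move=> x x' xx'; apply/rowP.
  - exact: continuous_second_cost.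
  - exact: measurable_feasible_recourse.
have sY y : Y y -> K2 (x1, s y, y) /\ recourse_value (x1, y) = second_cost x1 (s y).
  move=> Yy; have smin' := smin y (recourse K1x1 Yy).
  by split; [case: smin'|exact: recourse_value_argmin].
pose S (y : XY) : X1 * X2 * XY := (x1, s y, y).
have mS : measurable_fun setT S.
  apply: measurable_fun_pair => //; apply: measurable_fun_pair => //.
  exact: measurable_fun_rV.
pose S' : {mfun XY >-> (X1 * X2 * XY)%type} :=
  HB.pack S (isMeasurableFun.Build _ _ _ _ S mS).
exists (distribution phi S').
have SK2 y : K2 (S y) -> recourse_value (x1, y) = joint_cost (S y).
  by move=> [_ Yy _]; have [_ ->] := sY y Yy.
have mSK2 : measurable (S @^-1` K2).
  by rewrite -[X in measurable X]setTI; exact: (mS measurableT).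
have S_K2 : phi (~` (S @^-1` K2)) = 0%E.
  apply: (subset_measure0 (B := ~` Y)) => //; last exact: phi_notY.
  - exact: measurableC.
  - exact: measurableC.
  - by move=> y /= nK2 Yy; apply: nK2; have [] := sY y Yy.
split.
  split.
  - by rewrite /measure_on [LHS]diracE memNset//=; apply.
  - exact: S_K2.
  - by rewrite [LHS]integral_cst// mul1e [LHS]diracE mem_set.
  - move=> B mB BKY.
    have -> : (\d_x1 \x phi)%E B = phi (xsection B x1).
      rewrite /product_measure1 integral_dirac//.
        by rewrite diracT mul1e.
      exact: measurable_fun_xsection.
    rewrite [LHS](_ : _ = phi (S @^-1` [set z | K2 z /\ B (z.1.1, z.2)]))//.
    congr (phi _); apply/seteqP; split=> y.
      by move=> [_ By]; apply/xsectionP.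
    move=> /xsectionP By; split => //.
    by have [_ Yy] := BKY _ By; have [] := sY y Yy.
rewrite /gmp_cost stage1_costE// /expected_cost.
congr (_ + _)%E.
  rewrite integral_dirac//.
    by rewrite [X in (X * _)%E]diracE mem_set// mul1e.
  by apply/measurable_EFinP; apply: measurable_funTS; exact: measurable_first_cost.
have [M [f2M _]] := cost_bounded.
have mjoint_costS : measurable_fun setT (joint_cost \o S).
  exact: (measurableT_comp measurable_joint_cost mS).
transitivity (\int[phi]_(y in S @^-1` K2) ((EFin \o joint_cost) \o S) y)%E.
  apply: integral_pushforward => //.
  - by apply/measurable_EFinP; exact: measurable_joint_cost.
  - apply: (@integrable_of_bounded _ _ _ _ _ (joint_cost \o S) M) => //.
      exact: le_lt_trans (probability_le1 phi mSK2) (ltry 1).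
    by move=> y; exact: f2M.
transitivity (\int[phi]_(y in S @^-1` K2) (recourse_value (x1, y))%:E)%E.
  by apply: eq_integral => y /set_mem K2y; rewrite (SK2 y K2y).
rewrite [RHS](negligible_integral (N := ~` (S @^-1` K2)))//.
- by rewrite setTD setCK.
- exact: measurableC.
- exact: integrable_recourse_value.
Qed.

End upper_bound.

End problem.

Theorem theorem1 (R : realType) (n1 n2 p Nq Nh Ng Ng' : nat) (hN : (Ng <= Ng')%N)
  (D : recourse_data R n1 n2 p Nq Nh Ng Ng') (phi : probability 'rV[R]_p R)
  (phiY : phi (Y_set D) = 1%E)
  (cK1 : compact (K1_set D)) (cK2 : compact (K2_set D)) (cY : compact (Y_set D))
  (recourse : forall (x1 : 'rV[R]_n1) (y : 'rV[R]_p), K1_set D x1 -> Y_set D y ->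
    exists x2 : 'rV[R]_n2, K2_set D (x1, x2, y)) :
  rho12 D phi = rho D phi /\
  (forall x1 : 'rV[R]_n1, two_stage_optimal D phi x1 ->
     exists mu2 : {finite_measure set ('rV[R]_n1 * 'rV[R]_n2 * 'rV[R]_p)%type -> \bar R},
       gmp_optimal D phi \d_x1 mu2).
Proof.
have rho12E : rho12 D phi = rho D phi.
  apply/le_anti/andP; split.
    apply: le_ereal_inf_tmp => _ [x1 K1x1 <-].
    have [mu2 [feas <-]] := dirac_gmp cK1 cK2 cY recourse phiY K1x1.
    by apply: ereal_inf_lbound; exists \d_x1, mu2.
  apply: le_ereal_inf_tmp => _ [mu1 [mu2 [feas ->]]].
  exact: rho_le_gmp_cost.
split=> // x1 [K1x1 opt].
have [mu2 [feas cost]] := dirac_gmp cK1 cK2 cY recourse phiY K1x1.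
by exists mu2; split => //; rewrite cost opt.
Qed.
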